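(* Let $\mathfrak{A}$ be a $*$-algebra containing the $C^*$-algebra $\mathfrak{B}$ as a $*$-subalgebra, endowed with two $\mathfrak{B}$-valued conditional expectations $\Phi,\Psi:\mathfrak{A}\to\mathfrak{B}$. Let $X$ and $Y$ be two elements of $\mathfrak{A}$ that are c-free with respect to the pair of conditional expectations $(\Phi,\Psi)$. Then $${}^cR_{X+Y}={}^cR_X+{}^cR_Y .$$
   Context: A conditional expectation $\mathfrak{A}\to\mathfrak{B}$ is a linear $\mathfrak{B}$-bimodule map restricting to the identity on $\mathfrak{B}$. c-freeness: $*$-subalgebras $(\mathfrak{A}_i)_{i\in\mathcal{I}}$ of $\mathfrak{A}$ are c-free with respect to $(\Phi,\Psi)$ if for all $a_k\in\mathfrak{A}_{\varepsilon(k)}$, $1\le k\le m$, with $\varepsilon(1)\ne\varepsilon(2)\ne\dots\ne\varepsilon(m)$ (consecutive indices distinct) and $\Psi(a_k)=0$ for all $k$, one has (a) $\Psi(a_1\cdots a_m)=0$ (freeness with respect to $\Psi$) and (b) $\Phi(a_1\cdots a_m)=\Phi(a_1)\cdots\Phi(a_m)$. Elements $(X_i)_{i\in\mathcal{I}}$ are c-free with respect to $(\Phi,\Psi)$ if the $*$-subalgebras generated by $\mathfrak{B}$ and $X_i$ are. Multilinear function series: let $\widetilde{\mathfrak{B}}$ be $\mathfrak{B}$ if $\mathfrak{B}$ is unital and its unitization otherwise. $Mul[[\mathfrak{B}]]$ is the set of sequences $\omega=(\omega_0,\omega_1,\dots)$ with $\omega_0\in\widetilde{\mathfrak{B}}$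 and $\omega_n:\mathfrak{B}^n\to\mathfrak{B}$ multilinear for $n\ge1$; the sum is componentwise. Definition of ${}^cR_{\beta,\gamma}$: for $\beta,\gamma\in Mul[[\mathfrak{B}]]$, ${}^cR_{\beta,\gamma}\in Mul[[\mathfrak{B}]]$ is the series, with components ${}^cR_{\beta,\gamma,k}$, defined by the recurrence (for all $n\ge0$) $$\beta_n(b_1,\dots,b_n)=\sum_{k=0}^n\ \sum_{1=i(0)<i(1)<\dots<i(k)\le n+1}{}^cR_{\beta,\gamma,k}(c_1,\dots,c_k)\; r_{i(k)},$$ where $$c_j=b_{i(j-1)}\,\gamma_{p(j)}\big(b_{i(j-1)+1},\dots,b_{i(j)-2}\big)\,b_{i(j)-1},\qquad p(j)=i(j)-i(j-1)-2,$$ with the convention $c_j=b_{i(j-1)}$ when $p(j)=-1$, and where $r_i=b_i\,\beta_{n-i}(b_{i+1},\dots,b_n)$ if $i\le n$ and $r_{n+1}=1$. Moment series: for $X\in\mathfrak{A}$, the moment-generating multilinear function series of $X$ with respect to $\Psi$ is $\mathcal{M}_X$, with $\mathcal{M}_{X,0}=\Psi(X)$ and $\mathcal{M}_{X,n}(b_1,\dots,b_n)=\Psi(Xb_1X\cdots Xb_nX)$; with respect to $\Phi$ it is $\mathfrak{M}_X$, with $\mathfrak{M}_{X,0}=\Phi(X)$ and $\mathfrak{M}_{X,n}(b_1,\dots,b_n)=\Phi(Xb_1X\cdots Xb_nX)$. Then ${}^cR_X:={}^cR_{\mathfrak{M}_X,\mathcal{M}_X}$ (that is, $\beta=\mathfrak{M}_X$,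 $\gamma=\mathcal{M}_X$). *)

(* Defs.v *)
From HB Require Import structures.
From mathcomp Require Import all_boot all_order all_algebra.
From mathcomp Require Import boolp classical_sets functions reals.
From mathcomp Require Import topology normedtype.
From mathcomp Require Import complex.
From mathcomp Require Import zify.

Set Implicit Arguments.
Unset Strict Implicit.
Unset Printing Implicit Defensive.

Import Order.TTheory GRing.Theory Num.Theory.
Import numFieldNormedType.Exports.

Local Open Scope classical_set_scope.
Local Open Scope ring_scope.

Reserved Notation "x ** y" (at level 40, left associativity).

(* MathComp rings have a unit, whereas no unit is assumed here; the product is
   therefore an extra operation on a module over the scalars. *)
HB.mixin Record Lmodule_isStarAlgebra (C : numClosedFieldType) V
    of GRing.Lmodule C V := {
  smul : V -> V -> V;
  star : V -> V;
  smulA : associative smul;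
  smulDl : left_distributive smul +%R;
  smulDr : right_distributive smul +%R;
  smulZl : forall (c : C) x y, smul (c *: x) y = c *: smul x y;
  smulZr : forall (c : C) x y, smul x (c *: y) = c *: smul x y;
  starD : {morph star : x y / x + y};
  starZ : forall (c : C) x, star (c *: x) = c^* *: star x;
  starM : forall x y, star (smul x y) = smul (star y) (star x);
  starK : involutive star
}.

#[short(type="starAlgType")]
HB.structure Definition StarAlgebra (C : numClosedFieldType) :=
  {V of GRing.Lmodule C V & Lmodule_isStarAlgebra C V}.

Notation "x ** y" := (smul x y) : ring_scope.

HB.mixin Record isCStarAlgebra (R : realType) V
    of CompleteNormedModule R[i] V & StarAlgebra R[i] V := {
  cstar_normM : forall x y : V, `|x ** y| <= `|x| * `|y|;
  cstar_norm_star : forall x : V, `|star x ** x| = `|x| ^+ 2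
}.

#[short(type="cstarAlgType")]
HB.structure Definition CStarAlgebra (R : realType) :=
  {V of CompleteNormedModule R[i] V & StarAlgebra R[i] V
      & isCStarAlgebra R V}.

Section Unitization.
Context (C : numClosedFieldType) (B : starAlgType C).
Implicit Types (x y : B) (c : C).

Lemma smul0r x : 0 ** x = 0.
Proof. by rewrite -[X in X ** _](scale0r 0) smulZl scale0r. Qed.

Lemma smulr0 x : x ** 0 = 0.
Proof. by rewrite -[X in _ ** X](scale0r 0) smulZr scale0r. Qed.

Definition unitization : Type := (B * C^o)%type.
HB.instance Definition _ := GRing.Lmodule.copy unitization (B * C^o)%type.
Implicit Types u v w : unitization.

Definition unitz_mul u v : unitization :=
  (u.1 ** v.1 + u.2 *: v.1 + v.2 *: u.1, u.2 * v.2).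
Definition unitz_one : unitization := (0, 1).

Fact unitz_mulA : associative unitz_mul.
Proof.
move=> [x a] [y b] [z c]; rewrite /unitz_mul /=; congr pair; last exact: mulrA.
rewrite !smulDl !smulDr !smulZl !smulZr smulA !scalerDr !scalerA.
rewrite [c * a]mulrC [c * b]mulrC !addrA.
by rewrite [LHS](ACl (1*4*2*5*3*6*7)%AC).
Qed.

Fact unitz_mul1r : left_id unitz_one unitz_mul.
Proof.
by move=> [x a]; rewrite /unitz_mul /= smul0r scaler0 scale1r mul1r add0r addr0.
Qed.

Fact unitz_mulr1 : right_id unitz_one unitz_mul.
Proof.
by move=> [x a]; rewrite /unitz_mul /= smulr0 scaler0 scale1r mulr1 !add0r.
Qed.

Fact unitz_mulDl : left_distributive unitz_mul +%R.
Proof.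
move=> [x a] [y b] [z c]; rewrite /unitz_mul /=; congr pair; last exact: mulrDl.
rewrite !smulDl scalerDr scalerDl !addrA.
by rewrite [LHS](ACl (1*3*5*2*4*6)%AC).
Qed.

Fact unitz_mulDr : right_distributive unitz_mul +%R.
Proof.
move=> [x a] [y b] [z c]; rewrite /unitz_mul /=; congr pair; last exact: mulrDr.
rewrite !smulDr scalerDr scalerDl !addrA.
by rewrite [LHS](ACl (1*3*5*2*4*6)%AC).
Qed.

Fact unitz_one_neq0 : unitz_one != 0.
Proof. by apply/eqP => /(congr1 snd) /= /eqP; rewrite oner_eq0. Qed.

HB.instance Definition _ := GRing.Zmodule_isNzRing.Build unitization
  unitz_mulA unitz_mul1r unitz_mulr1 unitz_mulDl unitz_mulDr unitz_one_neq0.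

Fact unitz_scalerAl c u v : c *: (u * v) = (c *: u) * v.
Proof.
case: u v => [x a] [y b]; congr pair; last exact: mulrA.
by rewrite /= !scalerDr smulZl !scalerA [b * c]mulrC.
Qed.
HB.instance Definition _ :=
  GRing.Lmodule_isLalgebra.Build C unitization unitz_scalerAl.

Fact unitz_scalerAr c u v : c *: (u * v) = u * (c *: v).
Proof.
case: u v => [x a] [y b]; congr pair; last exact: mulrCA.
by rewrite /= !scalerDr smulZr !scalerA [a * c]mulrC.
Qed.
HB.instance Definition _ :=
  GRing.Lalgebra_isAlgebra.Build C unitization unitz_scalerAr.

Definition unitz_in x : unitization := (x, 0).

Fact unitz_in_is_linear : linear unitz_in.
Proof. by move=> c x y; rewrite /unitz_in; congr pair; rewrite /= scaler0 addr0. Qed.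
HB.instance Definition _ :=
  GRing.isLinear.Build C B unitization *:%R unitz_in unitz_in_is_linear.

Lemma unitz_inM x y : unitz_in (x ** y) = unitz_in x * unitz_in y.
Proof. by congr pair; rewrite /= ?scale0r ?addr0 ?mulr0. Qed.

Definition is_unity (e : B) : Prop := forall x, e ** x = x /\ x ** e = x.

(* The algebra B~, equal to B if B has a unit and to its unitization otherwise,
   is realised inside B (+) C: it consists of the pairs (x, 0) in the first
   case and of all pairs in the second.  Its unit element is chosen
   accordingly. *)
Definition in_tilde u : Prop := (exists e, is_unity e) -> u.2 = 0.

Definition tilde_one : unitization :=
  if pselect (exists e, is_unity e) is left h then unitz_in (sval (cid h))
  else 1.

Lemma in_tilde_one : in_tilde tilde_one.
Proof. by rewrite /tilde_one; case: pselect => [h hB|hN hB]; last case: hN. Qed.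

Lemma in_tilde_in x : in_tilde (unitz_in x).
Proof. by move=> _. Qed.

Lemma in_tildeD u v : in_tilde u -> in_tilde v -> in_tilde (u + v).
Proof. by move=> hu hv hB; rewrite /= hu// hv// addr0. Qed.

Lemma in_tildeM u v : in_tilde u -> in_tilde v -> in_tilde (u * v).
Proof. by move=> hu _ hB; rewrite /= hu// mul0r. Qed.

Lemma tilde_mulr1 u : in_tilde u -> u * tilde_one = u.
Proof.
rewrite /tilde_one; case: pselect => [h hu|_ _]; last exact: mulr1.
case: u hu => x a /(_ h) /= ->; rewrite -[(x, 0)]/(unitz_in x) -unitz_inM.
by case: (svalP (cid h) x) => _ ->.
Qed.

Lemma tilde_mul1r u : in_tilde u -> tilde_one * u = u.
Proof.
rewrite /tilde_one; case: pselect => [h hu|_ _]; last exact: mul1r.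
case: u hu => x a /(_ h) /= ->; rewrite -[(x, 0)]/(unitz_in x) -unitz_inM.
by case: (svalP (cid h) x) => ->.
Qed.

End Unitization.

Section MulSeries.
Context (C : numClosedFieldType) (B : starAlgType C).
Local Notation U := (unitization B).

Definition multilinear n (f : ('I_n -> B) -> B) : Prop :=
  forall (t : 'I_n) (b : 'I_n -> B),
    linear (fun x : B => f (@dfwith _ (fun=> B) b t x)).

(* The type Mul[[B]]. *)
Record mul_series := MulSeries {
  coef0 : U;
  coefS : forall n, ('I_n.+1 -> B) -> B;
  coef0P : in_tilde coef0;
  coefSP : forall n, multilinear (@coefS n)
}.

(* The n-th component; its values lie in B~ for n = 0, and in B for n > 0. *)
Definition coef (w : mul_series) n : ('I_n -> B) -> U :=
  match n with
  | 0 => fun=> coef0 w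
  | m.+1 => fun b => unitz_in (coefS w b)
  end.

Lemma mul_series_ext (v w : mul_series) :
  (forall n (b : 'I_n -> B), coef v b = coef w b) -> v = w.
Proof.
case: v w => v0 v1 v2 v3 [w0 w1 w2 w3] h.
have e0 : v0 = w0 by exact: (h 0%N (fun=> 0)).
have e1 : v1 = w1.
  apply: functional_extensionality_dep => n; apply: funext => b.
  exact: (congr1 fst (h n.+1 b)).
by subst; congr MulSeries; exact: Prop_irrelevance.
Qed.

Fact mul_series_add_subproof (v w : mul_series) n :
  multilinear (fun b : 'I_n.+1 -> B => coefS v b + coefS w b).
Proof.
by move=> t b a x y; rewrite !coefSP scalerDr !addrA [LHS](ACl (1*3*2*4)%AC).
Qed.

Definition mul_series_add (v w : mul_series) : mul_series :=
  MulSeries (in_tildeD (coef0P v) (coef0P w)) (mul_series_add_subproof v w).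

Lemma coef_add v w n (b : 'I_n -> B) :
  coef (mul_series_add v w) b = coef v b + coef w b.
Proof. by case: n b => [|n] b //=; rewrite linearD. Qed.

Implicit Types (w beta gamma rho : mul_series).

(* For a sequence b_1, b_2, ..., the arguments (b_l, ..., b_(l+n-1)). *)
Definition args (b : nat -> B) l n : 'I_n -> B := fun t => b (l + t)%N.

(* b_l gamma_(u-l-2)(b_(l+1), ..., b_(u-2)) b_(u-1), or b_l if u = l + 1.  The
   product is formed in B~ and lies in the ideal B. *)
Definition cR_block gamma (b : nat -> B) l u : B :=
  if u == l.+1 then b l
  else (unitz_in (b l) * coef gamma (args b l.+1 (n := (u - l - 2)%N))
        * unitz_in (b u.-1)).1.

(* r_i *)
Definition cR_tail beta n (b : nat -> B) i : U :=
  if (i <= n)%N then unitz_in (b i) * coef beta (args b i.+1 (n := (n - i)%N))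
  else tilde_one B.

(* 1 = i(0) < i(1) < ... < i(k) <= n+1 *)
Definition cR_index n k (i : {ffun 'I_k.+1 -> 'I_n.+2}) : bool :=
  (i ord0 == 1%N :> nat) &&
    [forall j : 'I_k.+1, forall l : 'I_k.+1, (j < l)%N ==> (i j < i l)%N].

Definition cR_term beta gamma rho n (b : nat -> B) k
    (i : {ffun 'I_k.+1 -> 'I_n.+2}) : U :=
  coef rho (fun j : 'I_k =>
    cR_block gamma b (i (widen_ord (leqnSn k) j)) (i (lift ord0 j)))
  * cR_tail beta n b (i ord_max).

(* b stands for the sequence b_1, b_2, ...; its term b 0 is not used *)
Definition cR_recurrence beta gamma rho : Prop :=
  forall n (b : nat -> B),
    coef beta (args b 1 (n := n)) =
    \sum_(k < n.+1) \sum_(i : {ffun 'I_k.+1 -> 'I_n.+2} | cR_index i)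
      cR_term beta gamma rho b i.


Lemma coefP w n (b : 'I_n -> B) : in_tilde (coef w b).
Proof. by case: n b => [|n] b; [exact: coef0P | exact: in_tilde_in]. Qed.

Definition agree_off (t : nat) (b b' : nat -> B) := forall s, s != t -> b' s = b s.

Lemma coef_lin w n (t : 'I_n) (f f1 f2 : 'I_n -> B) a :
  (forall s, s != t -> f1 s = f s) -> (forall s, s != t -> f2 s = f s) ->
  f t = a *: f1 t + f2 t -> coef w f = a *: coef w f1 + coef w f2.
Proof.
case: n t f f1 f2 => [[]//|n] t f f1 f2 h1 h2 ht /=.
have E (g : 'I_n.+1 -> B) : (forall s, s != t -> g s = f s) ->
    g = @dfwith _ (fun=> B) f t (g t).
  move=> hg; apply: funext => s; have [->|st] := eqVneq s t.
    by rewrite dfwith_in.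
  by rewrite dfwith_out 1?eq_sym// hg.
have Ef : f = @dfwith _ (fun=> B) f t (a *: f1 t + f2 t) by rewrite -ht; exact: E.
rewrite -linearP; congr unitz_in.
by rewrite [in LHS]Ef (coefSP w t f) -E// -E.
Qed.

Lemma coef_args_lin w n l t (b b1 b2 : nat -> B) a :
  agree_off t b b1 -> agree_off t b b2 -> b t = a *: b1 t + b2 t ->
  (l <= t < l + n)%N ->
  coef w (args b l (n := n)) =
  a *: coef w (args b1 l (n := n)) + coef w (args b2 l (n := n)).
Proof.
move=> h1 h2 ht /andP[lt tn].
have tn' : (t - l < n)%N by rewrite ltn_subLR.
have E s : s != Ordinal tn' -> (l + s)%N != t.
  by apply: contraNneq => E; apply/eqP/val_inj; rewrite /= -E addKn.
apply: (@coef_lin w n (Ordinal tn')); rewrite /args /= ?subnKC//.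
- by move=> s /E; exact: h1.
- by move=> s /E; exact: h2.
Qed.

Lemma args_eq l n (b b' : nat -> B) :
  (forall s, (l <= s < l + n)%N -> b' s = b s) ->
  args b' l (n := n) = args b l (n := n).
Proof.
by move=> h; apply: funext => s; apply: h; rewrite leq_addr ltn_add2l ltn_ord.
Qed.

Lemma args_off l n t (b b' : nat -> B) : agree_off t b b' ->
  ~~ (l <= t < l + n)%N -> args b' l (n := n) = args b l (n := n).
Proof.
move=> h ht; apply: args_eq => s hs; apply: h.
by apply: contraNneq ht => <-.
Qed.

Lemma cR_block_eq w l u (b b' : nat -> B) : (l < u)%N ->
  (forall s, (l <= s < u)%N -> b' s = b s) ->
  cR_block w b' l u = cR_block w b l u.
Proof.
move=> lu h; rewrite /cR_block; case: eqP => [_|/eqP ul].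
  by rewrite h// leqnn.
have {}lu : (l.+2 <= u)%N by rewrite ltn_neqAle eq_sym ul.
rewrite !h; try lia.
rewrite (@args_eq _ _ b)// => s /andP[ls su]; apply: h.
by lia.
Qed.

Lemma fstP a (u v : U) : (a *: u + v).1 = a *: u.1 + v.1.
Proof. by []. Qed.

Lemma cR_block_lin w l u t (b b1 b2 : nat -> B) a :
  agree_off t b b1 -> agree_off t b b2 -> b t = a *: b1 t + b2 t ->
  (l <= t < u)%N ->
  cR_block w b l u = a *: cR_block w b1 l u + cR_block w b2 l u.
Proof.
move=> h1 h2 ht /andP[lt tu]; rewrite /cR_block; case: eqP => [ul|/eqP ul].
  by have -> : l = t by apply/eqP; rewrite eqn_leq lt -ltnS -ul.
have {}lu : (l.+2 <= u)%N by rewrite ltn_neqAle eq_sym ul (leq_ltn_trans lt).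
rewrite -fstP; congr fst.
case: u tu ul lu => // u; rewrite ltnS => tu ul lu /=.
have E : (l.+1 + (u.+1 - l - 2) = u)%N by lia.
have [tl|tl] := eqVneq t l.
  rewrite -tl in E lu ul *.
  rewrite ht linearP !mulrDl -!scalerAl (h1 u) ?(h2 u); try lia.
  by rewrite !(args_off h1) ?(args_off h2)//; lia.
rewrite (h1 l) 1?eq_sym// (h2 l) 1?eq_sym//.
have [tu'|tu'] := eqVneq t u.
  rewrite -tu' ht linearP !mulrDr -!scalerAr.
  by rewrite !(args_off h1) ?(args_off h2)//; lia.
rewrite (h1 u) 1?eq_sym// (h2 u) 1?eq_sym//.
rewrite (coef_args_lin w h1 h2 ht); last lia.
by rewrite mulrDr mulrDl -scalerAr -scalerAl.
Qed.

Lemma cR_tail_eq w n i (b b' : nat -> B) :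
  (forall s, (i <= s <= n)%N -> b' s = b s) ->
  cR_tail w n b' i = cR_tail w n b i.
Proof.
move=> h; rewrite /cR_tail; case: ifP => // hi; rewrite h ?leqnn ?hi//.
by rewrite (@args_eq _ _ b)// => s; rewrite addSn subnKC// => hs; apply: h; lia.
Qed.

Lemma cR_tail_lin w n i t (b b1 b2 : nat -> B) a :
  agree_off t b b1 -> agree_off t b b2 -> b t = a *: b1 t + b2 t ->
  (i <= t <= n)%N ->
  cR_tail w n b i = a *: cR_tail w n b1 i + cR_tail w n b2 i.
Proof.
move=> h1 h2 ht /andP[lt tu]; rewrite /cR_tail (leq_trans lt tu).
have [ti|ti] := eqVneq t i.
  rewrite -ti ht linearP !mulrDl -!scalerAl.
  by rewrite !(args_off h1) ?(args_off h2)//; lia.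
rewrite (h1 i) 1?eq_sym// (h2 i) 1?eq_sym//.
rewrite (coef_args_lin w h1 h2 ht); last by lia.
by rewrite mulrDr -scalerAr.
Qed.

Lemma cR_indexP n k (i : {ffun 'I_k.+1 -> 'I_n.+2}) : cR_index i ->
  i ord0 = 1%N :> nat /\ forall j l : 'I_k.+1, (j < l)%N -> (i j < i l)%N.
Proof.
move=> /andP[/eqP i0 /'forall_forallP h]; split=> // j l jl.
by have := h j l; rewrite jl.
Qed.

Lemma cR_index_le n k (i : {ffun 'I_k.+1 -> 'I_n.+2}) : cR_index i ->
  forall j l : 'I_k.+1, (j <= l)%N -> (i j <= i l)%N.
Proof.
move=> /cR_indexP[_ h] j l; rewrite leq_eqVlt => /orP[/eqP/val_inj -> //|/h].
exact: ltnW.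
Qed.

Lemma cR_index_find n k (i : {ffun 'I_k.+1 -> 'I_n.+2}) t : cR_index i ->
  (0 < t < i ord_max)%N ->
  exists j : 'I_k, (i (widen_ord (leqnSn k) j) <= t < i (lift ord0 j))%N.
Proof.
move=> ci /andP[t0 tm].
have h m : (m <= k)%N -> (t < i (inord m))%N ->
    exists j : 'I_k, (i (widen_ord (leqnSn k) j) <= t < i (lift ord0 j))%N.
  elim: m => [|m IH] mk tm'.
    have [i0 _] := cR_indexP ci.
    have : inord 0 = ord0 :> 'I_k.+1 by apply: val_inj; rewrite /= inordK.
    by move=> E; rewrite E i0 in tm'; lia.
  have [tm2|tm2] := ltnP t (i (inord m)); first by apply: IH => //; exact: ltnW.
  exists (Ordinal mk).
  have -> : widen_ord (leqnSn k) (Ordinal mk) = inord m.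
    by apply: val_inj; rewrite /= inordK// ltnS ltnW.
  have -> : lift ord0 (Ordinal mk) = inord m.+1.
    by apply: val_inj; rewrite /= inordK.
  by rewrite tm2.
apply: (h k) => //; have -> // : inord k = ord_max :> 'I_k.+1.
by apply: val_inj; rewrite /= inordK.
Qed.

Lemma cR_index_lt n k (i : {ffun 'I_k.+1 -> 'I_n.+2}) (j : 'I_k) : cR_index i ->
  (i (widen_ord (leqnSn k) j) < i (lift ord0 j))%N.
Proof. by case/cR_indexP => _; apply. Qed.

Lemma cR_index_ge n k (i : {ffun 'I_k.+1 -> 'I_n.+2}) j : cR_index i ->
  (0 < i j)%N.
Proof. by move=> h; have := @cR_index_le _ _ _ h ord0 j (leq0n j); case: (cR_indexP h) => ->. Qed.

Lemma cR_term_eq beta gamma rho n k (i : {ffun 'I_k.+1 -> 'I_n.+2})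
    (b b' : nat -> B) : cR_index i ->
  (forall s, (0 < s <= n)%N -> b' s = b s) ->
  cR_term beta gamma rho b' i = cR_term beta gamma rho b i.
Proof.
move=> ci h; rewrite /cR_term; congr (_ * _).
  congr coef; apply: funext => j; apply: cR_block_eq; first exact: cR_index_lt.
  move=> s /andP[s1 s2]; apply: h; rewrite (leq_trans (cR_index_ge _ ci) s1)/=.
  by rewrite -ltnS (leq_trans s2)// -ltnS.
apply: cR_tail_eq => s /andP[s1 s2]; apply: h.
by rewrite (leq_trans (cR_index_ge _ ci) s1).
Qed.

Lemma cR_term_lin beta gamma rho n k (i : {ffun 'I_k.+1 -> 'I_n.+2}) t
    (b b1 b2 : nat -> B) a : cR_index i ->
  agree_off t b b1 -> agree_off t b b2 -> b t = a *: b1 t + b2 t ->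
  (0 < t <= n)%N ->
  cR_term beta gamma rho b i =
  a *: cR_term beta gamma rho b1 i + cR_term beta gamma rho b2 i.
Proof.
move=> ci h1 h2 ht /andP[t0 tn].
have off l u b' : (l < u)%N -> agree_off t b b' -> ~~ (l <= t < u)%N ->
    cR_block gamma b' l u = cR_block gamma b l u.
  move=> lu hb' htlu; apply: cR_block_eq => // s hs; apply: hb'.
  by apply: contraNneq htlu => <-.
have toff b' : agree_off t b b' -> (t < i ord_max)%N ->
    cR_tail beta n b' (i ord_max) = cR_tail beta n b (i ord_max).
  move=> hb' hi; apply: cR_tail_eq => s hs; apply: hb'; apply/eqP => st.
  by move: hi; rewrite -st; lia.
have [it|ti] := leqP (i ord_max) t.
  rewrite /cR_term (cR_tail_lin beta h1 h2 ht) ?it// mulrDr -scalerAr.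
  have E b' : agree_off t b b' -> forall j : 'I_k,
      cR_block gamma b' (i (widen_ord (leqnSn k) j)) (i (lift ord0 j)) =
      cR_block gamma b (i (widen_ord (leqnSn k) j)) (i (lift ord0 j)).
    move=> hb' j; apply: off => //; first exact: cR_index_lt.
    have : (i (lift ord0 j) <= i ord_max)%N by apply: cR_index_le => //; exact: leq_ord.
    by lia.
  by rewrite (funext (E _ h1)) (funext (E _ h2)).
have [|j hj] := cR_index_find ci (t := t); first by rewrite t0.
rewrite /cR_term !(toff b1)// !(toff b2)// scalerAl -mulrDl; congr (_ * _).
apply: (@coef_lin rho k j); last exact: (cR_block_lin gamma h1 h2 ht hj).
- move=> s sj; apply: off => //; first exact: cR_index_lt.
  have [sj'|sj'] := ltnP s j.
    have : (i (lift ord0 s) <= i (widen_ord (leqnSn k) j))%N by exact: cR_index_le.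
    by lia.
  have : (i (lift ord0 j) <= i (widen_ord (leqnSn k) s))%N.
    by apply: cR_index_le => //=; rewrite ltn_neqAle eq_sym sj.
  by lia.
- move=> s sj; apply: off => //; first exact: cR_index_lt.
  have [sj'|sj'] := ltnP s j.
    have : (i (lift ord0 s) <= i (widen_ord (leqnSn k) j))%N by exact: cR_index_le.
    by lia.
  have : (i (lift ord0 j) <= i (widen_ord (leqnSn k) s))%N.
    by apply: cR_index_le => //=; rewrite ltn_neqAle eq_sym sj.
  by lia.
Qed.

Lemma cR_term_snd beta gamma rho n k (i : {ffun 'I_k.+1 -> 'I_n.+2})
    (b : nat -> B) : cR_index i -> (0 < n)%N ->
  (cR_term beta gamma rho b i).2 = 0.
Proof.
case: n i => // n i ci _; case: k i ci => [|k] i ci.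
  have i1 : i ord_max = 1%N :> nat.
    by case: (cR_indexP ci) => i0 _; rewrite (ord1 ord_max).
  by rewrite /cR_term /cR_tail i1 /= mul0r mulr0.
by rewrite /cR_term /= mul0r.
Qed.

Lemma cR_term_coef beta gamma rho rho' n k (i : {ffun 'I_k.+1 -> 'I_n.+2}) b :
  coef rho (n:=k) = coef rho' (n:=k) ->
  cR_term beta gamma rho b i = cR_term beta gamma rho' b i.
Proof. by rewrite /cR_term => ->. Qed.

(* The term k = n has the single index i(j) = j + 1. *)
Lemma cR_top beta gamma rho n (b : nat -> B) :
  \sum_(i : {ffun 'I_n.+1 -> 'I_n.+2} | cR_index i) cR_term beta gamma rho b i
  = coef rho (args b 1 (n := n)).
Proof.
pose i0 : {ffun 'I_n.+1 -> 'I_n.+2} := [ffun j => lift ord0 j].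
rewrite (big_pred1 i0) => [|i].
  rewrite /cR_term /cR_tail ffunE /= /bump leq0n add1n ltnn tilde_mulr1.
    congr (coef rho _); apply: funext => j.
    by rewrite /cR_block !ffunE /= /bump /= !add1n eqxx.
  exact: coefP.
apply/idP/eqP => [ci|->].
  have hlo (j : 'I_n.+1) : (j < i j)%N.
    case: j => m; elim: m => [|m IH] hm.
      exact: cR_index_ge.
    have [_ h] := cR_indexP ci.
    exact: leq_ltn_trans (IH (ltnW hm)) (h (Ordinal (ltnW hm)) (Ordinal hm) _).
  have hhi d (j : 'I_n.+1) : (d <= n - j)%N -> (i j + d <= n.+1)%N.
    elim: d j => [|d IH] j; first by move=> _; rewrite addn0 -ltnS ltn_ord.
    move=> hd; have jn : (j.+1 < n.+1)%N by lia.
    have [_ /(_ j (Ordinal jn) (leqnn _)) h] := cR_indexP ci.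
    have h' := IH (Ordinal jn).
    by rewrite addnS -addSn (leq_trans _ (h' _)) ?leq_add2r//=; lia.
  apply/ffunP => j; apply: ord_inj; rewrite ffunE /= /bump leq0n add1n.
  apply/eqP; rewrite eqn_leq hlo andbT -(leq_add2r (n - j)) addSn.
  by rewrite subnKC ?hhi// -ltnS ltn_ord.
apply/andP; split; first by rewrite ffunE.
apply/'forall_forallP => j l; apply/implyP => jl.
by rewrite !ffunE /= /bump !leq0n.
Qed.

Definition cR_low beta gamma rho n (b : nat -> B) : U :=
  \sum_(k < n) \sum_(i : {ffun 'I_k.+1 -> 'I_n.+2} | cR_index i)
    cR_term beta gamma rho b i.

Lemma cR_recurrenceE beta gamma rho : cR_recurrence beta gamma rho <->
  forall n (b : nat -> B), coef beta (args b 1 (n := n)) =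
    cR_low beta gamma rho n b + coef rho (args b 1 (n := n)).
Proof. by split=> h n b; rewrite h big_ord_recr /= cR_top. Qed.

Lemma cR_low_coef beta gamma rho rho' n (b : nat -> B) :
  (forall k, (k < n)%N -> coef rho (n:=k) = coef rho' (n:=k)) ->
  cR_low beta gamma rho n b = cR_low beta gamma rho' n b.
Proof.
move=> h; apply: eq_bigr => k _; apply: eq_bigr => i _.
by apply: cR_term_coef; exact: h.
Qed.

(* (b_1, ..., b_n) completed into a sequence, indexed from 1. *)
Definition seq_of_args n (b : 'I_n -> B) (i : nat) : B :=
  if i is j.+1 then oapp b 0 (insub j) else 0.

Lemma args_seq_of_args n (b : 'I_n -> B) : args (seq_of_args b) 1 (n := n) = b.
Proof. by apply: funext => t; rewrite /args /= valK. Qed.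

Lemma cR_recurrence_uniq beta gamma rho rho' :
  cR_recurrence beta gamma rho -> cR_recurrence beta gamma rho' -> rho = rho'.
Proof.
move=> /cR_recurrenceE h /cR_recurrenceE h'; apply: mul_series_ext => n b.
suff -> : coef rho (n:=n) = coef rho' (n:=n) by [].
elim/ltn_ind: n {b} => n IH; apply: funext => b.
rewrite -(args_seq_of_args b); apply: (addrI (cR_low beta gamma rho n (seq_of_args b))).
by rewrite -h h'; congr (_ + _); apply: cR_low_coef => k /IH.
Qed.

Let new_coef beta gamma rho n (b : 'I_n.+1 -> B) : B :=
  coefS beta b - (cR_low beta gamma rho n.+1 (seq_of_args b)).1.

Lemma new_coefP beta gamma rho n : multilinear (new_coef beta gamma rho (n:=n)).
Proof.
move=> t b a x y; rewrite /new_coef coefSP scalerBr addrACA -opprD; congr (_ - _).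
rewrite -fstP; congr fst; rewrite /cR_low scaler_sumr -big_split/=.
apply: eq_bigr => k _; rewrite scaler_sumr -big_split/=.
apply: eq_bigr => i ci.
have E z : seq_of_args (@dfwith _ (fun=> B) b t z) t.+1 = z.
  by rewrite /= valK /= dfwith_in.
have off z z' : agree_off t.+1 (seq_of_args (@dfwith _ (fun=> B) b t z))
                               (seq_of_args (@dfwith _ (fun=> B) b t z')).
  case=> // s; rewrite eqSS /= => st; case: insubP => // j _ js /=.
  by rewrite !dfwith_out// eq_sym -val_eqE /= js.
apply: (@cR_term_lin beta gamma rho _ _ i t.+1) => //; first by rewrite !E.
by rewrite /= ltn_ord.
Qed.

Let next beta gamma rho : mul_series :=
  MulSeries (coef0P beta) (@new_coefP beta gamma rho).

Lemma next_local beta gamma rho rho' n :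
  (forall k, (k < n)%N -> coef rho (n:=k) = coef rho' (n:=k)) ->
  coef (next beta gamma rho) (n:=n) = coef (next beta gamma rho') (n:=n).
Proof.
case: n => // n h; apply: funext => b /=.
by congr unitz_in; rewrite /new_coef (cR_low_coef beta gamma (rho':=rho')).
Qed.

Lemma cR_exists beta gamma : exists rho, cR_recurrence beta gamma rho.
Proof.
pose T := next beta gamma; pose r n := iter n T beta.
have stab n m : (m <= n)%N -> coef (r n) (n:=m) = coef (r m) (n:=m).
  elim/ltn_ind: n m => -[|n] IH [|m] // mn.
  rewrite /r !iterS; apply: next_local => k km.
  rewrite -/(r n) -/(r m) (IH n _ k) ?ltnSn//; last first.
    by rewrite -ltnS (leq_trans km) // ltnW.
  by rewrite (IH m _ k).
pose rho := @MulSeries (coef0 beta) (fun m => coefS (r m.+1) (n:=m))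
  (coef0P beta) (fun m => @coefSP (r m.+1) m).
have rhoE m : coef rho (n:=m) = coef (r m) (n:=m) by case: m.
exists rho; apply/cR_recurrenceE => n b.
have -> : coef rho (n:=n) = coef (T rho) (n:=n).
  case: n {b} => // n; rewrite rhoE {1}/r iterS; apply: next_local => k kn.
  by rewrite rhoE stab//; lia.
case: n b => [|n] b /=; first by rewrite /cR_low big_ord0 add0r.
rewrite /new_coef.
have -> : cR_low beta gamma rho n.+1 (seq_of_args (args b 1 (n:=n.+1))) =
          cR_low beta gamma rho n.+1 b.
  apply: eq_bigr => k _; apply: eq_bigr => i ci; apply: cR_term_eq => // s.
  by case: s => // s /andP[_ sn] /=; rewrite insubT.
rewrite raddfB /= addrC.
suff -> : unitz_in (cR_low beta gamma rho n.+1 b).1 = cR_low beta gamma rho n.+1 b.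
  by rewrite subrK.
apply/esym; rewrite [LHS]surjective_pairing; congr pair.
rewrite /cR_low raddf_sum /= big1// => k _; rewrite raddf_sum /= big1// => i ci.
exact: cR_term_snd.
Qed.

Definition cR beta gamma : mul_series := sval (cid (cR_exists beta gamma)).

Lemma cRP beta gamma : cR_recurrence beta gamma (cR beta gamma).
Proof. exact: svalP (cid (cR_exists beta gamma)). Qed.

End MulSeries.

Section CFreeness.
Context (C : numClosedFieldType) (B A : starAlgType C).

(* B as a *-subalgebra of A *)
Record star_embedding := StarEmbedding {
  emb_fun :> {linear B -> A};
  emb_smul : forall x y, emb_fun (x ** y) = emb_fun x ** emb_fun y;
  emb_star : forall x, emb_fun (star x) = star (emb_fun x);
  emb_inj : injective emb_fun
}.

Context (iota : star_embedding).
Implicit Types (a X : A) (b : B).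

Record cond_exp := CondExp {
  ce_fun :> {linear A -> B};
  ce_smull : forall b a, ce_fun (iota b ** a) = b ** ce_fun a;
  ce_smulr : forall a b, ce_fun (a ** iota b) = ce_fun a ** b;
  ce_id : forall b, ce_fun (iota b) = b
}.

Definition star_subalgebra (S : set A) : Prop :=
  [/\ S 0,
      forall (c : C) x y, S x -> S y -> S (c *: x + y),
      forall x y, S x -> S y -> S (x ** y)
    & forall x, S x -> S (star x)].

(* The *-subalgebra generated by B and X *)
Definition gen_star_subalgebra X : set A :=
  smallest star_subalgebra (range iota `|` [set X]).

(* a_0 ** ... ** a_m *)
Fixpoint smul_prod (V : starAlgType C) (a : nat -> V) m : V :=
  match m with
  | 0 => a 0%N
  | m'.+1 => smul_prod a m' ** a m
  end.

(* The letters of a word are numbered from 0 to m. *)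
Definition c_free_family (Phi Psi : cond_exp) (I : Type) (S : I -> set A) : Prop :=
  forall (m : nat) (eps : nat -> I) (a : nat -> A),
    (forall k, (k <= m)%N -> S (eps k) (a k)) ->
    (forall k, (k < m)%N -> eps k <> eps k.+1) ->
    (forall k, (k <= m)%N -> Psi (a k) = 0) ->
    Psi (smul_prod a m) = 0 /\
    Phi (smul_prod a m) = smul_prod (fun k => Phi (a k)) m.

Definition c_free_elements (Phi Psi : cond_exp) (I : Type) (X : I -> A) : Prop :=
  c_free_family Phi Psi (fun i => gen_star_subalgebra (X i)).

Definition c_free (Phi Psi : cond_exp) (X Y : A) : Prop :=
  c_free_elements Phi Psi (fun i : bool => if i then X else Y).

(* X b_1 X ... b_n X *)
Definition moment_word X n (b : 'I_n -> B) : A :=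
  foldl (fun w c => w ** iota c ** X) X (codom b).

Fact moment_word_linear X n (t : 'I_n) (b : 'I_n -> B) :
  linear (fun x => moment_word X (@dfwith _ (fun=> B) b t x)).
Proof.
move=> c x y; rewrite /moment_word.
pose f := fun w d => w ** iota d ** X; rewrite -/f.
have f_lin s w v : foldl f (c *: w + v) s = c *: foldl f w s + foldl f v s.
  elim: s w v => //= e s IH w v.
  by rewrite -IH; congr foldl; rewrite /f !smulDl !smulZl.
have eq_f r z w : t \notin r ->
    foldl f w [seq @dfwith _ (fun=> B) b t z i | i <- r] = foldl f w (map b r).
  elim: r w => //= s r IH w; rewrite inE negb_or => /andP[ts tr].
  by rewrite dfwith_out// IH.
suff gen r w : t \in r -> uniq r ->
    foldl f w [seq @dfwith _ (fun=> B) b t (c *: x + y) i | i <- r] =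
    c *: foldl f w [seq @dfwith _ (fun=> B) b t x i | i <- r] +
    foldl f w [seq @dfwith _ (fun=> B) b t y i | i <- r].
  by rewrite /codom /image_mem gen ?enum_uniq ?mem_enum.
elim: r w => //= s r IH w; rewrite inE => /predU1P[<-|tr].
  move=> /andP[tr _]; rewrite !eq_f// !dfwith_in -f_lin; congr foldl.
  by rewrite /f linearP smulDr smulZr smulDl smulZl.
move=> /andP[sr ur]; have ts : t != s by apply: contraNneq sr => <-.
by rewrite !dfwith_out//; exact: IH.
Qed.

Fact moment_series_subproof (E : cond_exp) X n :
  multilinear (fun b : 'I_n.+1 -> B => E (moment_word X b)).
Proof. by move=> t b c x y; rewrite moment_word_linear linearP. Qed.

Definition moment_series (E : cond_exp) X : mul_series B :=
  MulSeries (in_tilde_in (E X)) (moment_series_subproof E X).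

Definition cR_of (Phi Psi : cond_exp) X : mul_series B :=
  cR (moment_series Phi X) (moment_series Psi X).

End CFreeness.

(* Main.v *)
Require Import Defs.
From mathcomp Require Import all_boot all_order all_algebra.
From mathcomp Require Import boolp classical_sets.
From mathcomp Require Import reals complex zify.

(** The proof reads the recurrence defining the c-free R-transform as the
    output of a transducer, which makes it linear algebra instead of a sum over
    index sequences.

    Write Z for an element of A.  By the recurrence,
    Phi(Z b_1 Z ... b_n Z) is a sum over the sets of marked occurrences of Z
    that contain the first one: the stretches between consecutive marks are
    replaced by their Psi-expectations, which become the arguments of the
    R-transform, and the stretch after the last mark is replaced by its
    Phi-expectation.  Scanning the word from left to right, one has to remember
    the list of the arguments already completed and the product a of the
    letters seen since the last mark.  A function of such a state (s, a) is a
    [readout]; a letter that cannot be marked acts on readouts by [rmul], and a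
    letter Z that may be marked acts by [mark].  Applied to the final readout
    [read], these operators compute the right-hand side of the recurrence
    ([sum_cR_term], [word_op_recurrence]).

    The theorem reduces to the following claim about the word
    X b_1 Z b_2 ... b_n Z with Z = X + Y: if every Z is expanded, marks are put on
    occurrences of X only, and the transform of X is used, then the sum over the
    marks is Phi(X b_1 Z ... b_n Z) ([word_op_cfree]).  In this sum, as in the one
    for Y, the stretches between the marks are words in Z; hence the two add up
    to the recurrence of X + Y, with the sum of the two transforms in place of
    the unknown, and this recurrence has a unique solution.

    For the claim, a product of polynomials in X and in Y is carried along with
    the operator that it induces on readouts.  Since the centering of a
    polynomial can be done on both components at once, every word is a
    combination of alternating products of centered polynomials times a scalar
    of B ([alt_span_word]).  On such a product p_1 p_2 ... p_m, only marks in a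
    leading X-polynomial survive: any other mark would complete an argument that
    is the Psi-expectation of an alternating product whose factors, the two ends
    excepted, are centered, and freeness makes it vanish ([Psi_split2],
    [alternating_read]).  For the surviving marks the claim is the recurrence of
    X itself, because Phi(p_1 p_2 ... p_m) = Phi(p_1) Phi(p_2 ... p_m)
    ([Phi_split]).

    As neither algebra is assumed to have a unit, products are formed in their
    unitizations, to which the embedding, the conditional expectations and
    c-freeness extend: an element of the unitization whose expectation is zero
    has no scalar part. *)

Set Implicit Arguments.
Unset Strict Implicit.
Unset Printing Implicit Defensive.

Import GRing.Theory.
Local Open Scope ring_scope.

(** * The index sequences of the recurrence *)

Fixpoint subseqs t r : seq (seq nat) :=
  if r is r'.+1 then subseqs t.+1 r' ++ map (cons t) (subseqs t.+1 r')
  else [:: [::]].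

Lemma mem_subseqs t r s :
  (s \in subseqs t r) = sorted ltn s && all (fun x => t <= x < t + r)%N s.
Proof.
elim: r t s => [|r IH] t [|x s]; rewrite /= ?mem_cat ?inE ?IH ?orbT//=.
  by apply/esym/negP => /andP[_ /andP[]]; lia.
have -> : (x :: s \in map (cons t) (subseqs t.+1 r)) =
    (x == t) && (s \in subseqs t.+1 r).
  apply/mapP/andP => [[s' hs' [-> ->]]|[/eqP -> hs]]; first by rewrite eqxx.
  by exists s.
rewrite IH; rewrite !(path_sortedE ltn_trans).
case: (sorted _ s); rewrite ?andbF//= !andbT.
have [->|xt] := eqVneq x t => /=.
  rewrite ltnn /= leqnn andbF /=.
  have -> : (t < t + r.+1)%N by lia.
  by rewrite -all_predI; apply: eq_all => y /=; lia.
rewrite orbF.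
have [/allP xs|//] := boolP (all (ltn x) s).
have -> : (t < x < t.+1 + r)%N = (t <= x < t + r.+1)%N by lia.
have [xx|//] := boolP (t <= x < t + r.+1)%N => /=.
by apply: eq_in_all => y /xs /= xy; lia.
Qed.

Lemma subseqs_uniq t r : uniq (subseqs t r).
Proof.
elim: r t => //= r IH t; rewrite cat_uniq IH map_inj_uniq ?IH ?andbT/=;
  last by move=> ? ? [].
apply/hasPn => _ /mapP[s _ ->]; rewrite mem_subseqs/= ltnn /=; lia.
Qed.

(** The value i(0) = 1 is common to all the index sequences and is left out. *)
Definition cR_seq n k (i : {ffun 'I_k.+1 -> 'I_n.+2}) : seq nat :=
  [seq val (i (lift ord0 j)) | j <- enum 'I_k].

Lemma size_cR_seq n k (i : {ffun 'I_k.+1 -> 'I_n.+2}) : size (cR_seq i) = k.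
Proof. by rewrite size_map size_enum_ord. Qed.

Lemma nth_cR_seq n k (i : {ffun 'I_k.+1 -> 'I_n.+2}) x (j : 'I_k) :
  nth x (cR_seq i) j = i (lift ord0 j).
Proof. by rewrite (nth_map j) ?size_enum_ord// nth_ord_enum. Qed.

Lemma nth_cons_cR_seq n k (i : {ffun 'I_k.+1 -> 'I_n.+2}) x (j : 'I_k.+1) :
  i ord0 = 1%N :> nat -> nth x (1%N :: cR_seq i) j = i j.
Proof.
move=> i0; case: (unliftP ord0 j) => [j'|] -> /=; last by rewrite i0.
by rewrite nth_cR_seq.
Qed.

Lemma cR_index_sorted n k (i : {ffun 'I_k.+1 -> 'I_n.+2}) :
  cR_index i = (i ord0 == 1%N :> nat) && sorted ltn (1%N :: cR_seq i).
Proof.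
apply/idP/andP => [/cR_indexP[i0 h]|[/eqP i0 h]].
  split; first exact/eqP.
  apply/(sortedP 0%N) => j; rewrite /= size_cR_seq ltnS => jk.
  have jk' : (j < k.+1)%N by lia.
  have jk2 : (j.+1 < k.+1)%N by lia.
  have := h (Ordinal jk') (Ordinal jk2) (ltnSn j).
  by rewrite -!(nth_cons_cR_seq 0 _ i0).
apply/andP; split; first exact/eqP.
apply/'forall_forallP => j l; apply/implyP => jl.
rewrite -(nth_cons_cR_seq 0 j i0) -(nth_cons_cR_seq 0 l i0).
by apply: (sorted_ltn_nth ltn_trans) => //; rewrite inE /= size_cR_seq.
Qed.

(** Once its first value is fixed to 1, an increasing map is determined by the
    list of its other values. *)
Lemma sum_cR_index_size (V : nmodType) n k (G : seq nat -> V) :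
  \sum_(i : {ffun 'I_k.+1 -> 'I_n.+2} | cR_index i) G (cR_seq i) =
  \sum_(s <- subseqs 2 n | size s == k) G s.
Proof.
rewrite -[RHS]big_filter -[LHS]big_filter.
rewrite -(big_map (@cR_seq n k) xpredT G); apply: perm_big; apply: uniq_perm.
- rewrite map_inj_in_uniq ?filter_uniq ?index_enum_uniq// => i i'.
  rewrite !mem_filter => /andP[/cR_indexP[i0 _] _] /andP[/cR_indexP[i0' _] _] e.
  apply/ffunP => j; apply: val_inj.
  by rewrite /= -(nth_cons_cR_seq 0 j i0) -(nth_cons_cR_seq 0 j i0') e.
- by rewrite filter_uniq// subseqs_uniq.
move=> s; rewrite mem_filter mem_subseqs; apply/mapP/idP.
  case=> i; rewrite mem_filter cR_index_sorted => /andP[/andP[i0 si] _] ->.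
  move: si; rewrite /= size_cR_seq eqxx (path_sortedE ltn_trans) => /andP[h ->] /=.
  apply/allP => x hx; move/allP: h => /(_ x hx) /= -> /=.
  by case/mapP: hx => j _ ->; rewrite add2n /= ltn_ord.
move=> /and3P[/eqP sk ss hs].
have lt (j : 'I_k.+1) : (nth 0 (1 :: s) j < n.+2)%N.
  case: j => -[|j] //= jk; rewrite -(add2n n).
  by have /(allP hs)/andP[] : nth 0%N s j \in s by rewrite mem_nth ?sk.
exists [ffun j => Ordinal (lt j)].
  rewrite mem_filter cR_index_sorted mem_index_enum andbT ffunE /=.
  suff -> : cR_seq [ffun j => Ordinal (lt j)] = s.
    by rewrite (path_sortedE ltn_trans) ss andbT; apply/allP => x /(allP hs) /andP[].
  apply: (@eq_from_nth _ 0%N); first by rewrite size_cR_seq.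
  move=> j; rewrite size_cR_seq => jk.
  by rewrite (nth_cR_seq _ 0 (Ordinal jk)) ffunE.
apply: (@eq_from_nth _ 0%N); first by rewrite size_cR_seq.
move=> j; rewrite sk => jk.
by rewrite (nth_cR_seq _ 0 (Ordinal jk)) ffunE.
Qed.

(** The double sum of the recurrence, over the length k and the increasing
    maps i, ranges over the increasing lists of indices in [2, n+1]: this
    removes the dependency of the type of i on k. *)
Lemma sum_cR_index (V : nmodType) n (G : seq nat -> V) :
  \sum_(k < n.+1) \sum_(i : {ffun 'I_k.+1 -> 'I_n.+2} | cR_index i) G (cR_seq i)
  = \sum_(s <- subseqs 2 n) G s.
Proof.
under eq_bigr => k _ do rewrite sum_cR_index_size.
rewrite (exchange_big_dep xpredT)//=; rewrite !big_seq; apply: eq_bigr => s.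
have size_le t r u : u \in subseqs t r -> (size u <= r)%N.
  elim: r t u => [|r IH] t u /=; first by rewrite inE => /eqP ->.
  rewrite mem_cat => /orP[/IH /leqW|/mapP[u' /IH h ->]] //.
move=> /size_le; rewrite -ltnS => sn.
rewrite (big_pred1 (Ordinal sn))// => k.
Qed.

(** * Embedding and expectations on the unitizations *)

Section UnitizedMaps.
Context (C : numClosedFieldType) (B A : starAlgType C).
Context (iota : star_embedding B A).
Implicit Types (c : unitization B) (u v : unitization A) (E : cond_exp iota).

Definition uemb c : unitization A := (iota c.1, c.2).

Definition uexp E u : unitization B := (E u.1, u.2).

Lemma uemb1 : uemb 1 = 1.
Proof. by rewrite /uemb /= linear0. Qed.

Lemma uembM : {morph uemb : c c' / c * c'}.
Proof. by move=> c c'; rewrite /uemb /= !linearD /= !linearZ emb_smul. Qed.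

Lemma uemb_in b : uemb (unitz_in b) = unitz_in (iota b).
Proof. by []. Qed.

Lemma uexpD E : {morph uexp E : u v / u + v}.
Proof. by move=> u v; rewrite /uexp /= linearD. Qed.

Lemma uexpB E : {morph uexp E : u v / u - v}.
Proof. by move=> u v; rewrite /uexp /= linearB. Qed.

Lemma uexp_embl E c u : uexp E (uemb c * u) = c * uexp E u.
Proof.
rewrite /uexp /=; congr pair => /=.
by rewrite !linearD /= !linearZ /= ce_smull ce_id.
Qed.

Lemma uexp_embr E u c : uexp E (u * uemb c) = uexp E u * c.
Proof.
rewrite /uexp /=; congr pair => /=.
by rewrite !linearD /= !linearZ /= ce_smulr ce_id.
Qed.

Lemma uexp_emb E c : uexp E (uemb c) = c.
Proof. by rewrite /uexp /= ce_id -surjective_pairing. Qed.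

Lemma uexp_in E a : uexp E (unitz_in a) = unitz_in (E a).
Proof. by []. Qed.

Lemma unitz_in_smul_prod (V : starAlgType C) (a : nat -> V) m :
  unitz_in (smul_prod a m) = \prod_(k < m.+1) unitz_in (a k).
Proof.
elim: m => [|m IH]; first by rewrite big_ord_recr big_ord0 /= mul1r.
by rewrite big_ord_recr /= -IH unitz_inM.
Qed.

Lemma unitz_in_foldl_word X w (s : seq B) :
  unitz_in (foldl (fun w b => w ** iota b ** X) w s) =
  unitz_in w * \prod_(x <- s) (unitz_in (iota x) * unitz_in X).
Proof.
elim: s w => [|x s IH] w /=; first by rewrite big_nil mulr1.
by rewrite IH big_cons !unitz_inM !mulrA.
Qed.

Lemma codom_args (b : nat -> B) l n :
  codom (args b l (n := n)) = [seq b t | t <- seq.iota l n].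
Proof.
rewrite /codom /image_mem enumT -[in RHS](addn0 l) iotaDl -map_comp.
by rewrite -val_enum_ord -map_comp -enumT.
Qed.

Lemma unitz_in_moment_args X (b : nat -> B) l n :
  unitz_in (moment_word iota X (args b l (n := n))) =
  unitz_in X * \prod_(t <- seq.iota l n) (unitz_in (iota (b t)) * unitz_in X).
Proof.
by rewrite /moment_word codom_args unitz_in_foldl_word big_map.
Qed.

(** In the unitization, moments of all orders, including 0, have a single
    formula. *)
Lemma coef_moment E X (b : nat -> B) l n :
  coef (moment_series E X) (args b l (n := n)) = uexp E
    (unitz_in X * \prod_(t <- seq.iota l n) (unitz_in (iota (b t)) * unitz_in X)).
Proof.
rewrite -unitz_in_moment_args; case: n => [|n] //=.
by rewrite /moment_word /codom /image_mem enum_ord0.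
Qed.

End UnitizedMaps.

Section Coefs.
Context (C : numClosedFieldType) (B : starAlgType C).
Implicit Types (w : mul_series B).

(** The arguments are given by a list, so that the number of arguments, which
    varies along a scan of a word, does not appear in the type. *)
Definition coefs w (s : seq B) : unitization B :=
  coef w (fun j : 'I_(size s) => nth 0 s j).

Lemma coefsE w n (f : 'I_n -> B) (s : seq B) :
  size s = n -> (forall j : 'I_n, f j = nth 0 s j) -> coef w f = coefs w s.
Proof. by move=> sn; case: n / sn f => f h; congr coef; apply: funext. Qed.

Lemma coefs_add v w s : coefs (mul_series_add v w) s = coefs v s + coefs w s.
Proof. exact: coef_add. Qed.

End Coefs.

(** * The recurrence as a transducer *)

Section Transducer.
Context (C : numClosedFieldType) (B A : starAlgType C).
Context (iota : star_embedding B A) (Phi Psi : cond_exp iota).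
Implicit Types (c : unitization B) (p a : unitization A) (X Z : A).

(** A state (s, a) of the scan consists of the arguments s of the R-transform
    completed so far and of the product a of the letters since the last mark. *)
Definition readout := seq B -> unitization A -> unitization B.
Implicit Types (h : readout).

Definition rmul p h : readout := fun s a => h s (a * p).

(** The letter Z is either left unmarked, and then multiplies the current
    product, or marked: then the current product is turned into an argument by
    Psi, and a new product starts at 1. *)
Definition mark Z h : readout :=
  fun s a => h s (a * unitz_in Z) + h (rcons s (uexp Psi a).1) 1.

(** The final value R(s) Phi(a).  The factor c receives the expectations that
    factor out on the right, as right multiplication by B commutes with the whole
    scan. *)
Definition read w c : readout := fun s a => coefs w s * uexp Phi a * c.

Definition word_op Z (r : seq B) h : readout :=
  foldr (fun b g => rmul (unitz_in (iota b)) (mark Z g)) h r.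

Section Recurrence.
Variables (Z : A) (w : mul_series B) (n : nat) (b : nat -> B).

(** The product of the letters since the mark l, before the letter t. *)
Definition segment l t : unitization A :=
  \prod_(u <- seq.iota l (t - l)) (unitz_in (iota (b u)) * unitz_in Z).

Local Notation block := (cR_block (moment_series Psi Z) b).
Local Notation tail := (cR_tail (moment_series Phi Z) n b).

Lemma segmentS l t : (l <= t)%N ->
  segment l t.+1 = segment l t * (unitz_in (iota (b t)) * unitz_in Z).
Proof.
by move=> lt; rewrite /segment subSn// -addn1 iotaD big_cat big_seq1 /= subnKC.
Qed.

Lemma segment_cons l t : (l < t)%N ->
  segment l t = unitz_in (iota (b l)) * unitz_in Z * segment l.+1 t.
Proof.
by move=> lt; rewrite /segment -[(t - l)%N]prednK ?subn_gt0// /= big_cons subnS.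
Qed.

Lemma segmentnn l : segment l l = 1.
Proof. by rewrite /segment subnn big_nil. Qed.

Lemma block_segment l t : (l <= t)%N ->
  block l t.+1 = (uexp Psi (segment l t * unitz_in (iota (b t)))).1.
Proof.
move=> lt; rewrite /cR_block eqSS; case: eqP => [->|/eqP tl].
  by rewrite segmentnn mul1r /= ce_id.
have {}lt : (l < t)%N by rewrite ltn_neqAle eq_sym tl.
rewrite segment_cons// coef_moment -!uemb_in uexp_embr -!mulrA uexp_embl.
by rewrite mulrA /segment; have -> : (t.+1 - l - 2 = t - l.+1)%N by lia.
Qed.

(** The remainder l = n + 1 is the unit chosen for B~, which need not be that of
    the unitization; the two agree after multiplication by an element of B~. *)
Lemma tail_segment l : (l <= n.+1)%N ->
  forall s, coefs w s * tail l = coefs w s * uexp Phi (segment l n.+1).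
Proof.
move=> ln s; rewrite /cR_tail; case: ifPn => [{}ln|].
  rewrite segment_cons// -!uemb_in coef_moment -mulrA uexp_embl.
  by rewrite /segment subSS.
move=> nl; have -> : l = n.+1 by lia.
rewrite segmentnn -(uemb1 iota) uexp_emb mulr1 tilde_mulr1 //; exact: (coefP w).
Qed.

(** The invariant of the scan: when the letters before t have been read and s
    is the list of the marks among them, what remains to be summed are the
    terms whose list of marks extends s by marks after t.  The mark at the
    occurrence of Z that follows b_t has index t + 1. *)
Lemma word_op_read r t s : (r + t = n.+1)%N ->
  (last 1 s <= t)%N ->
  word_op Z [seq b u | u <- seq.iota t r] (read w 1)
    (pairmap block 1%N s) (segment (last 1%N s) t) =
  \sum_(s' <- subseqs t.+1 r)
    coefs w (pairmap block 1%N (s ++ s')) * tail (last 1%N (s ++ s')).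
Proof.
elim: r t s => [|r IH] t s /= rt lst.
  by rewrite big_seq1 cats0 tail_segment -?rt// /read mulr1.
rewrite big_cat big_map /= -IH; first last.
- by lia.
- by rewrite -rt; lia.
rewrite /rmul /mark; congr (_ + _); first by rewrite segmentS// mulrA.
under eq_bigr => s' _ do rewrite -cat_rcons.
rewrite -IH ?last_rcons ?segmentnn; [|lia|by []].
by rewrite -[in RHS]cats1 pairmap_cat /= cats1 block_segment.
Qed.

Lemma sum_cR_term :
  \sum_(k < n.+1) \sum_(i : {ffun 'I_k.+1 -> 'I_n.+2} | cR_index i)
     cR_term (moment_series Phi Z) (moment_series Psi Z) w b i =
  word_op Z (codom (args b 1 (n := n))) (read w 1) [::] 1.
Proof.
rewrite codom_args -(segmentnn 1%N) (@word_op_read _ _ [::]) ?addn1//=.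
rewrite -sum_cR_index; apply: eq_bigr => k _; apply: eq_bigr => i ci.
have [i0 _] := cR_indexP ci.
rewrite /cR_term; congr (_ * tail _).
  apply: coefsE; rewrite ?size_pairmap ?size_cR_seq// => j.
  rewrite (nth_pairmap 0%N) ?size_cR_seq// nth_cR_seq; congr (block _ _).
  by rewrite -(nth_cons_cR_seq 0 _ i0).
by rewrite -(nth_cons_cR_seq 0 _ i0) (last_nth 0%N) size_cR_seq.
Qed.

End Recurrence.

End Transducer.

(** * C-freeness for alternating products *)

Section CFreeProducts.
Context (C : numClosedFieldType) (B A : starAlgType C).
Context (iota : star_embedding B A) (Phi Psi : cond_exp iota).
Implicit Types (c d : unitization B) (p q a v : unitization A) (X Y Z : A).
Implicit Types (l : seq (unitization A)).

(** As the scalar part is arbitrary, this is the unital algebra generated by B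
    and X. *)
Definition in_ugen X u := gen_star_subalgebra iota X (u : unitization A).1.

Lemma gen_star_subalgebraP X : star_subalgebra (gen_star_subalgebra iota X).
Proof.
split.
- by move=> S [[]].
- by move=> c x y hx hy S SX; case: (SX) => -[_ + _ _] _; apply; [exact: hx|exact: hy].
- by move=> x y hx hy S SX; case: (SX) => -[_ _ + _] _; apply; [exact: hx|exact: hy].
- by move=> x hx S SX; case: (SX) => -[_ _ _ +] _; apply; exact: hx.
Qed.

Lemma in_ugen_var X : in_ugen X (unitz_in X).
Proof. by move=> S [_]; apply; right. Qed.

Lemma in_ugen_emb X c : in_ugen X (uemb iota c).
Proof. by move=> S [_]; apply; left; exists c.1. Qed.

Lemma in_ugen1 X : in_ugen X 1.
Proof. by rewrite -(uemb1 iota); exact: in_ugen_emb. Qed.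

Lemma in_ugenB X p q : in_ugen X p -> in_ugen X q -> in_ugen X (p - q).
Proof.
have [_ lin _ _] := gen_star_subalgebraP X => hp hq.
by rewrite /in_ugen addrC -scaleN1r; exact: lin.
Qed.

Lemma in_ugenM X p q : in_ugen X p -> in_ugen X q -> in_ugen X (p * q).
Proof.
have [S0 lin mul _] := gen_star_subalgebraP X => hp hq.
rewrite /in_ugen /= [X in gen_star_subalgebra _ _ X]addrC; apply: (lin) => //.
by rewrite addrC; apply: lin => //; exact: mul.
Qed.

Lemma uexp_center (E : cond_exp iota) a : uexp E (a - uemb iota (uexp E a)) = 0.
Proof. by rewrite uexpB uexp_emb subrr. Qed.

Variables X Y : A.
Hypothesis free : c_free Phi Psi X Y.

Local Notation in_alg s := (in_ugen (if s then X else Y)).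

Fixpoint centered s l : Prop :=
  if l is a :: l' then [/\ in_alg s a, uexp Psi a = 0 & centered (~~ s) l']
  else True.

Lemma centered_nth s l k : centered s l -> (k < size l)%N ->
  in_alg (s (+) odd k) l`_k /\ uexp Psi l`_k = 0.
Proof.
elim: k s l => [|k IH] s [|a l] //= [h1 h2 h3]; first by rewrite addbF.
by rewrite ltnS => /(IH _ _ h3); rewrite addNb -addbN.
Qed.

Lemma centered_rcons s l a : centered s l -> in_alg (s (+) odd (size l)) a ->
  uexp Psi a = 0 -> centered s (rcons l a).
Proof.
elim: l s => [|b l IH] s /=; first by rewrite addbF.
by move=> [h1 h2 h3] ha ha0; split=> //; apply: IH => //; rewrite addNb -addbN.
Qed.

(** C-freeness in the unitizations: a centered element has no scalar part, hence
    is an element of the algebra generated by B and a variable. *)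
Lemma centered_prod s l : centered s l ->
  (l != [::] -> uexp Psi (\prod_(a <- l) a) = 0) /\
  uexp Phi (\prod_(a <- l) a) = \prod_(a <- l) uexp Phi a.
Proof.
case: l => [|a l].
  by move=> _; split=> //; rewrite !big_nil -(uemb1 iota) uexp_emb.
set al := a :: l => hl.
have al_in k : (k <= size l)%N -> al`_k = unitz_in (al`_k).1.
  move=> kl; have [_ /(congr1 snd) /= h] := centered_nth hl (k := k) kl.
  by rewrite [LHS]surjective_pairing h.
have [||| PsiE PhiE] := free (m := size l) (eps := fun k => s (+) odd k)
    (a := fun k => (al`_k).1).
- by move=> k kl; have [] := centered_nth hl (k := k) kl.
- by move=> k kl /=; case: s {hl} => /=; case: (odd k).
- by move=> k kl; have [_ /(congr1 fst)] := centered_nth hl (k := k) kl.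
have -> : \prod_(x <- al) x = unitz_in (smul_prod (fun k => (al`_k).1) (size l)).
  rewrite unitz_in_smul_prod (big_nth 0) big_mkord.
  by apply: eq_bigr => k _; apply: al_in; rewrite -ltnS.
rewrite !uexp_in PsiE PhiE linear0; split=> //.
rewrite unitz_in_smul_prod [RHS](big_nth 0) big_mkord.
by apply: eq_bigr => k _; rewrite -uexp_in -al_in// -ltnS.
Qed.

(** For the part Psi(v) of v in B the equality holds by left B-linearity, and
    the rest of v is centered. *)
Lemma Phi_split s v l : in_alg s v -> centered (~~ s) l ->
  uexp Phi (v * \prod_(a <- l) a) = uexp Phi v * uexp Phi (\prod_(a <- l) a).
Proof.
move=> hv hl; set m := uexp Psi v.
have hvl : centered s (v - uemb iota m :: l).
  split=> //; last exact: uexp_center.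
  by apply: in_ugenB => //; exact: in_ugen_emb.
have [_] := centered_prod hvl; rewrite !big_cons; have [_ <-] := centered_prod hl.
by rewrite mulrBl !uexpB uexp_embl uexp_emb mulrBl => /addIr.
Qed.

(** The part Psi(v) of v in B leaves an alternating product of centered factors,
    and the rest of v is centered. *)
Lemma Psi_split s v l : in_alg s v -> centered (~~ s) l -> l != [::] ->
  uexp Psi (v * \prod_(a <- l) a) = 0.
Proof.
move=> hv hl l0; set m := uexp Psi v.
have hvl : centered s (v - uemb iota m :: l).
  split=> //; last exact: uexp_center.
  by apply: in_ugenB => //; exact: in_ugen_emb.
have [/(_ isT) + _] := centered_prod hvl; have [/(_ l0) h _] := centered_prod hl.
by rewrite big_cons mulrBl uexpB uexp_embl h mulr0 subr0.
Qed.

(** The same with both end factors arbitrary.  This is what makes the mark of an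
    occurrence of X inside an alternating product contribute nothing. *)
Lemma Psi_split2 s v l p : in_alg s v -> centered (~~ s) l -> l != [::] ->
  in_alg (~~ s (+) odd (size l)) p ->
  uexp Psi (v * \prod_(a <- l) a * p) = 0.
Proof.
move=> hv hl l0 hp; set m := uexp Psi p.
have hlp : centered (~~ s) (rcons l (p - uemb iota m)).
  apply: centered_rcons => //; last exact: uexp_center.
  by apply: in_ugenB => //; exact: in_ugen_emb.
have lp0 : rcons l (p - uemb iota m) != [::] by case: (l).
have := Psi_split hv hlp lp0.
rewrite big_rcons /= mulrA mulrBr uexpB uexp_embr (Psi_split hv)// mul0r subr0.
by [].
Qed.

End CFreeProducts.

(** * Polynomials in one variable and their operators *)

Section MarkedPolynomials.
Context (C : numClosedFieldType) (B A : starAlgType C).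
Context (iota : star_embedding B A) (Phi Psi : cond_exp iota) (X : A).
Implicit Types (c d : unitization B) (p q a v : unitization A).
Local Notation readout := (readout B A).
Implicit Types (h : readout) (P Q : readout -> readout).
Local Notation uemb := (uemb iota).
Local Notation in_ugen := (in_ugen iota X).
Local Notation markX := (mark Psi X).

(** A polynomial in X with coefficients in B, with the operator obtained by
    allowing each occurrence of X to be marked.  The operator is attached to a
    polynomial expression and not to its value, hence the relation.  Every X is
    preceded by a coefficient in B: the arguments of the R-transform lie in B,
    and a mark that follows directly another mark would complete the argument 1,
    which need not be in B. *)
Inductive marked_poly : unitization A -> (readout -> readout) -> Prop :=
| Marked1 : marked_poly 1 id
| MarkedB p P q Q : marked_poly p P -> marked_poly q Q ->
    marked_poly (p - q) (fun h s a => P h s a - Q h s a)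
| MarkedC p P c : marked_poly p P ->
    marked_poly (p * uemb c) (P \o rmul (uemb c))
| MarkedX p P b : marked_poly p P ->
    marked_poly (p * (unitz_in (iota b) * unitz_in X))
      (P \o rmul (unitz_in (iota b)) \o markX).

Lemma marked_poly_in p P : marked_poly p P -> in_ugen p.
Proof.
elim=> {p P} [|p P q Q _ hp _ hq|p P c _ hp|p P b _ hp].
- exact: in_ugen1.
- exact: in_ugenB.
- by apply: in_ugenM => //; exact: in_ugen_emb.
- apply: in_ugenM => //; apply: in_ugenM; last exact: in_ugen_var.
  by rewrite -uemb_in; exact: in_ugen_emb.
Qed.

Lemma marked_polyDop p P : marked_poly p P -> forall h h',
  P (fun s a => h s a + h' s a) = (fun s a => P h s a + P h' s a).
Proof.
elim=> {p P} [|p P q Q _ hp _ hq|p P c _ hp|p P b _ hp] h h' //.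
- by rewrite hp hq; apply/funext => s; apply/funext => a; rewrite opprD addrACA.
- exact: hp.
- rewrite /= -hp; congr P; apply/funext => s; apply/funext => a.
  by rewrite /rmul /mark addrACA.
Qed.

Lemma marked_polyBop p P : marked_poly p P -> forall h h',
  P (fun s a => h s a - h' s a) = (fun s a => P h s a - P h' s a).
Proof.
move=> hp h h'; have := marked_polyDop hp (fun s a => h s a - h' s a) h'.
have -> : (fun s a => h s a - h' s a + h' s a) = h.
  by apply/funext => s; apply/funext => a; rewrite subrK.
by move=> ->; apply/funext => s; apply/funext => a; rewrite addrK.
Qed.

Lemma marked_polyM p P q Q : marked_poly p P -> marked_poly q Q ->
  marked_poly (p * q) (P \o Q).
Proof.
move=> hp; elim=> {q Q} [|q Q r S _ hq _ hr|q Q c _ hq|q Q b _ hq].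
- by rewrite mulr1.
- rewrite mulrBr; have := MarkedB hq hr; congr marked_poly.
  by apply/funext => h; rewrite /= (marked_polyBop hp).
- by rewrite mulrA; exact: (MarkedC c hq).
- by rewrite mulrA; exact: (MarkedX b hq).
Qed.

(** Scanning a polynomial in X from a state whose current product is a
    polynomial in X only meets such states, since each mark resets this product
    to 1. *)
Lemma marked_poly_ext p P h h' : marked_poly p P ->
  (forall s v, in_ugen v -> h s v = h' s v) ->
  forall s v, in_ugen v -> P h s v = P h' s v.
Proof.
move=> hP; elim: hP h h' => {p P}
  [|p P q Q _ hp _ hq|p P c _ hp|p P b _ hp] h h' hh s v hv /=.
- exact: hh.
- by congr (_ - _); [apply: hp|apply: hq].
- apply: hp => // {}s {}v {}hv; apply: hh; apply: in_ugenM => //.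
  exact: in_ugen_emb.
- have hb : in_ugen (unitz_in (iota b)) by rewrite -uemb_in; exact: in_ugen_emb.
  apply: hp => // {}s {}v {}hv; rewrite /rmul /mark; congr (_ + _); apply: hh.
    apply: in_ugenM; last exact: in_ugen_var.
    exact: in_ugenM.
  exact: in_ugen1.
Qed.

(** Additivity in the current product lets the centering of polynomials in Y act
    on readouts as it does on elements.  It is preserved by marks only together
    with additivity in every completed argument, which also makes a readout
    vanish when a mark completes the argument 0. *)
Definition multiadditive h :=
  (forall s a a', h s (a - a') = h s a - h s a') /\
  (forall s s' x y a,
     h (s ++ (x - y) :: s') a = h (s ++ x :: s') a - h (s ++ y :: s') a).

Lemma multiadditive0 h s a : multiadditive h -> 0 \in s -> h s a = 0.
Proof.
move=> [_ hs] /path.splitPr[s1 s2].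
by rewrite -(subrr 0) hs subrr.
Qed.

Lemma multiadditive_rmul p h : multiadditive h -> multiadditive (rmul p h).
Proof.
move=> [h1 h2]; split=> [s a a'|s s' x y a]; rewrite /rmul ?h2//.
by rewrite mulrBl h1.
Qed.

Lemma multiadditive_mark h : multiadditive h -> multiadditive (markX h).
Proof.
move=> [h1 h2]; split=> [s a a'|s s' x y a]; rewrite /mark.
  by rewrite mulrBl h1 uexpB -!cats1 h2 opprD addrACA.
by rewrite !rcons_cat !rcons_cons !h2 opprD addrACA.
Qed.

Lemma multiadditive_marked_poly p P h :
  marked_poly p P -> multiadditive h -> multiadditive (P h).
Proof.
move=> hP; elim: hP h => {p P} [|p P q Q _ hp _ hq|p P c _ hp|p P b _ hp] h hh //=.
- have [p1 p2] := hp _ hh; have [q1 q2] := hq _ hh.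
  split=> [s a a'|s s' x y a]; first by rewrite p1 q1 opprD addrACA -opprD.
  by rewrite p2 q2 opprD addrACA -opprD.
- by apply: hp; exact: multiadditive_rmul.
- by apply/hp/multiadditive_rmul/multiadditive_mark.
Qed.

(** If the current product a satisfies Psi(a v) = 0 for every polynomial v in X,
    any mark put in p completes the argument 0: only the term without marks
    remains. *)
Lemma marked_poly_unmarked p P h s a : marked_poly p P -> multiadditive h ->
  (forall v, in_ugen v -> uexp Psi (a * v) = 0) -> P h s a = h s (a * p).
Proof.
move=> hP hh ha; elim: hP h hh => {p P}
  [|p P q Q _ hp _ hq|p P c hP hp|p P b hP hp] h hh /=.
- by rewrite mulr1.
- by rewrite hp// hq// mulrBr hh.1.
- by rewrite hp ?mulrA//; exact: multiadditive_rmul.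
- rewrite hp; last exact/multiadditive_rmul/multiadditive_mark.
  rewrite /rmul /mark -[a * p * _]mulrA ha; last first.
    by apply: in_ugenM; [exact: marked_poly_in hP|rewrite -uemb_in; exact: in_ugen_emb].
  rewrite !mulrA [X in _ + X]multiadditive0 ?addr0//.
  by rewrite mem_rcons inE eqxx.
Qed.

Lemma read_rmul w c d : rmul (uemb d) (read Phi w c) = read Phi w (d * c).
Proof.
apply/funext => s; apply/funext => a.
by rewrite /rmul /read uexp_embr !mulrA.
Qed.

Lemma word_op_read_scale Z w r c : word_op Psi Z r (read Phi w c) =
  (fun s a => word_op Psi Z r (read Phi w 1) s a * c).
Proof.
apply/funext => s; apply/funext => a.
elim: r s a => [|b r IH] s a /=; first by rewrite /read mulr1.
by rewrite /rmul /mark !IH mulrDl.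
Qed.

Lemma coefs_multiadditive (w : mul_series B) s s' x y :
  coefs w (s ++ (x - y) :: s') = coefs w (s ++ x :: s') - coefs w (s ++ y :: s').
Proof.
pose n := (size s + (size s').+1)%N.
have E z : coefs w (s ++ z :: s') = coef w (fun j : 'I_n => nth 0 (s ++ z :: s') j).
  by apply/esym/coefsE => //; rewrite size_cat.
have sn : (size s < n)%N by rewrite /n; lia.
have off z z' (j : 'I_n) : j != Ordinal sn ->
    (s ++ z :: s')`_j = (s ++ z' :: s')`_j.
  rewrite -val_eqE /= !nth_cat; case: ltnP => // sj js.
  by rewrite -[(j - size s)%N]prednK// subn_gt0 ltn_neqAle eq_sym js.
rewrite !E [RHS]addrC -[- coef w _]scaleN1r.
apply: (@coef_lin _ _ _ _ (Ordinal sn)) => [j|j|]; [exact: off|exact: off|].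
by rewrite /= !nth_cat ltnn subnn /= scaleN1r addrC.
Qed.

Lemma multiadditive_read w c : multiadditive (read Phi w c).
Proof.
split=> [s a a'|s s' x y a]; rewrite /read.
  by rewrite uexpB mulrBr mulrBl.
by rewrite coefs_multiadditive !mulrBl.
Qed.

Variable w : mul_series B.

(** The recurrence of Z, read as a scan of the word b_1 Z b_2 Z ... b_n Z. *)
Lemma word_op_recurrence Z r :
  cR_recurrence (moment_series Phi Z) (moment_series Psi Z) w ->
  word_op Psi Z r (read Phi w 1) [::] 1 =
  uexp Phi (unitz_in Z * \prod_(b <- r) (unitz_in (iota b) * unitz_in Z)).
Proof.
(* The recurrence numbers its arguments from 1. *)
move=> hw; pose b := nth 0 (0 :: r).
have rE : r = [seq b t | t <- seq.iota 1 (size r)].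
  by rewrite (iotaDl 1 0) -map_comp -[LHS](mkseq_nth 0).
rewrite {1}rE -codom_args -sum_cR_term -hw coef_moment.
by rewrite -(big_map b xpredT (fun x => unitz_in (iota x) * unitz_in Z)) -rE.
Qed.

Hypothesis hw : cR_recurrence (moment_series Phi X) (moment_series Psi X) w.

(** The recurrence of X extends from words to polynomials in X by linearity.
    The induction peels the letters of p from the right, hence the word r that
    collects them. *)
Lemma marked_poly_word p P r c : marked_poly p P ->
  P (word_op Psi X r (read Phi w c)) [::] 1 =
  uexp Phi (unitz_in X * p *
            \prod_(b <- r) (unitz_in (iota b) * unitz_in X)) * c.
Proof.
move=> hP; elim: hP r c => {p P} [|p P q Q _ hp _ hq|p P d _ hp|p P b _ hp] r c /=.
- by rewrite word_op_read_scale word_op_recurrence// mulr1.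
- by rewrite hp hq mulrBr mulrBl uexpB mulrBl.
- case: r => [|b r] /=.
    by rewrite read_rmul (hp [::]) !big_nil !mulr1 (mulrA (unitz_in X)) uexp_embr mulrA.
  (* B is an ideal of its unitization: the scalar d is absorbed by the
     coefficient of the next letter. *)
  have := hp ((d * unitz_in b).1 :: r) c => /=; rewrite !big_cons.
  have -> : unitz_in (iota (d * unitz_in b).1) = uemb d * unitz_in (iota b).
    rewrite -!uemb_in -uembM; congr uemb.
    by apply/esym; rewrite [LHS]surjective_pairing; congr pair; exact: mulr0.
  rewrite !mulrA => <-; congr P.
  by apply/funext => s; apply/funext => a; rewrite /rmul mulrA.
- by rewrite (hp (b :: r)) big_cons !mulrA.
Qed.

Lemma marked_poly_read p P c : marked_poly p P ->
  P (read Phi w c) [::] 1 = uexp Phi (unitz_in X * p) * c.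
Proof. by move=> /(marked_poly_word [::]) /= ->; rewrite big_nil mulr1. Qed.

End MarkedPolynomials.

(** * Alternating products and additivity *)

Section AlternatingSpan.
Context (C : numClosedFieldType) (B A : starAlgType C).
Context (iota : star_embedding B A) (Phi Psi : cond_exp iota) (X Y : A).
Local Notation readout := (readout B A).
Local Notation pair_op := (unitization A * (readout -> readout))%type.
Implicit Types (c d : unitization B) (p q a v t : unitization A) (s : bool).
Implicit Types (h : readout) (P Q T : readout -> readout) (l : seq pair_op).
Local Notation uemb := (uemb iota).
Local Notation in_alg s := (in_ugen iota (if s then X else Y)).

(** Marks are put on X only: a polynomial in Y acts by multiplication. *)
Definition letter s p P : Prop :=
  if s then marked_poly Psi X p P else in_ugen iota Y p /\ P = rmul p.

Lemma letter_in s p P : letter s p P -> in_alg s p.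
Proof. by case: s => [/marked_poly_in|[]]. Qed.

Lemma letter_uemb s c : letter s (uemb c) (rmul (uemb c)).
Proof.
case: s => /=; last by split=> //; exact: in_ugen_emb.
by have := MarkedC c (Marked1 Psi X); rewrite mul1r.
Qed.

Lemma letterM s p P q Q : letter s p P -> letter s q Q -> letter s (p * q) (P \o Q).
Proof.
case: s => /=; first exact: marked_polyM.
move=> [hp ->] [hq ->]; split; first exact: in_ugenM.
by apply/funext => h; apply/funext => r; apply/funext => a; rewrite /rmul /= mulrA.
Qed.

Lemma letterDop s p P : letter s p P -> forall h h',
  P (fun r a => h r a + h' r a) = (fun r a => P h r a + P h' r a).
Proof. by case: s => [/marked_polyDop|[_ ->]]. Qed.

Lemma multiadditive_letter s p P h :
  letter s p P -> multiadditive h -> multiadditive (P h).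
Proof.
by case: s => [/multiadditive_marked_poly|[_ ->]]; [apply|exact: multiadditive_rmul].
Qed.

(** The decomposition p = p0 + Psi(p) with p0 centered holds for elements and
    for operators at once. *)
Lemma letter_center s p P : letter s p P -> exists p0 P0,
  [/\ letter s p0 P0, uexp Psi p0 = 0, p = p0 + uemb (uexp Psi p)
    & forall h, multiadditive h ->
        P h = fun r a => P0 h r a + h r (a * uemb (uexp Psi p))].
Proof.
move=> hp; exists (p - uemb (uexp Psi p)); set m := uexp Psi p.
case: s hp => [hp|[hp ->]].
  exists (fun h r a => P h r a - rmul (uemb m) h r a); split.
  - exact: (MarkedB hp (letter_uemb true m)).
  - exact: uexp_center.
  - by rewrite subrK.
  - by move=> h _; apply/funext => r; apply/funext => a; rewrite subrK.
exists (rmul (p - uemb m)); split.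
- by split=> //; apply: in_ugenB => //; exact: in_ugen_emb.
- exact: uexp_center.
- by rewrite subrK.
- move=> h [h1 _]; apply/funext => r; apply/funext => a.
  by rewrite /rmul mulrBr h1 subrK.
Qed.

Fixpoint alternating s l : Prop :=
  if l is (q, Q) :: l' then [/\ letter s q Q, uexp Psi q = 0 & alternating (~~ s) l']
  else True.

Definition lprod l : unitization A := \prod_(x <- [seq y.1 | y <- l]) x.
Definition lop l h := foldr (fun x g => x.2 g) h l.

Lemma lprod_cons q Q l : lprod ((q, Q) :: l) = q * lprod l.
Proof. by rewrite /lprod /= big_cons. Qed.

Lemma lprod_nil : lprod [::] = 1.
Proof. by rewrite /lprod big_nil. Qed.

Lemma alternating_centered s l :
  alternating s l -> centered Psi X Y s [seq x.1 | x <- l].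
Proof.
elim: l s => [|[q Q] l IH] s //= [hq q0 hl].
by split=> //; [exact: letter_in hq|exact: IH].
Qed.

Lemma multiadditive_lop s l h :
  alternating s l -> multiadditive h -> multiadditive (lop l h).
Proof.
elim: l s => [|[q Q] l IH] s //= [hq q0 hl] hh.
by apply: multiadditive_letter hq _; exact: IH hl hh.
Qed.

(** The combinations of alternating products of centered letters, with a
    coefficient in B on the right; the empty product accounts for the scalars. *)
Inductive alt_span : unitization A -> (readout -> readout) -> Prop :=
| AltSpan s l c t T : alternating s l -> t = lprod l * uemb c ->
    (forall h, multiadditive h -> T h = lop l (rmul (uemb c) h)) -> alt_span t T
| AltSpanD t T t' T' t1 T1 : alt_span t T -> alt_span t' T' -> t1 = t + t' ->
    (forall h, multiadditive h -> T1 h = fun r a => T h r a + T' h r a) ->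
    alt_span t1 T1.

Lemma alt_span_ext t T t' T' : alt_span t T -> t' = t ->
  (forall h, multiadditive h -> T' h = T h) -> alt_span t' T'.
Proof.
case=> {t T} [s l c t T hl -> hT|t T t1 T1 t2 T2 ht ht1 -> hT] -> hT'.
  by apply: (AltSpan (c := c) hl) => // h hh; rewrite hT' ?hT.
by apply: (AltSpanD ht ht1) => // h hh; rewrite hT' ?hT.
Qed.

(** A scalar on the left is absorbed by the first letter, which remains
    centered. *)
Lemma alt_span_uemb d s l c : alternating s l ->
  alt_span (uemb d * (lprod l * uemb c))
           (fun h => rmul (uemb d) (lop l (rmul (uemb c) h))).
Proof.
case: l => [_|[q Q] l /= [hq q0 hl]].
  apply: (@AltSpan s [::] (d * c)) => //; first by rewrite lprod_nil !mul1r uembM.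
  move=> h _; apply/funext => r; apply/funext => a.
  by rewrite /rmul /= uembM mulrA.
apply: (@AltSpan s ((uemb d * q, rmul (uemb d) \o Q) :: l) c) => //.
  split=> //; first by apply: letterM => //; exact: letter_uemb.
  by rewrite uexp_embl q0 mulr0.
by rewrite !lprod_cons !mulrA.
Qed.

(** Centering p gives the longer alternating product that starts with p0, and
    the scalar Psi(p) times the given one. *)
Lemma alt_span_push s p P l c : letter s p P -> alternating (~~ s) l ->
  alt_span (p * (lprod l * uemb c)) (fun h => P (lop l (rmul (uemb c) h))).
Proof.
move=> hp hl; have [p0 [P0 [hp0 p00 pE PE]]] := letter_center hp.
have h1 : alternating s ((p0, P0) :: l) by [].
apply: (AltSpanD (AltSpan (c := c) h1 erefl (fun h _ => erefl))
                 (alt_span_uemb (uexp Psi p) c hl)).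
  by rewrite {1}pE mulrDl lprod_cons mulrA.
move=> h hh; rewrite PE//; apply: multiadditive_lop hl _.
exact: multiadditive_rmul.
Qed.

(** When the first letter of the product is of the same kind as p, the two are
    merged before centering, and the remaining product starts with a letter of
    the other kind. *)
Lemma alt_spanM s p P t T : letter s p P -> alt_span t T ->
  alt_span (p * t) (P \o T).
Proof.
move=> hp; elim=> {t T} [s' l c t T hl -> hT|t T t1 T1 t2 T2 _ h1 _ h2 -> hT].
  have gen l' q Q : letter s q Q -> alternating (~~ s) l' ->
      p * (lprod l * uemb c) = q * (lprod l' * uemb c) ->
      (forall h, P (lop l h) = Q (lop l' h)) ->
      alt_span (p * (lprod l * uemb c)) (P \o T).
    move=> hq hl' e E; apply: (alt_span_ext (alt_span_push c hq hl')) => //.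
    by move=> h hh; rewrite /= hT ?E.
  have [e|ss'] := eqVneq s' (~~ s); first by apply: (gen l _ _ hp) => //; rewrite -e.
  have {ss'} e : s' = s by case: s s' ss' {hl hp gen} => -[].
  rewrite e {s' e} in hl; case: l hl gen {hT} => [|[q Q] l] hl gen.
    exact: (gen [::] p P).
  move: hl => [hq _ hl]; apply: (gen l (p * q) (P \o Q)) => //; first exact: letterM.
  by rewrite lprod_cons !mulrA.
apply: (AltSpanD h1 h2); first by rewrite mulrDr.
by move=> h hh /=; rewrite hT// (letterDop hp).
Qed.

Lemma multiadditive_word_op Z r h :
  multiadditive h -> multiadditive (word_op Psi Z r h).
Proof.
elim: r => //= b r IH hh.
by apply: multiadditive_rmul; apply: multiadditive_mark; exact: IH.
Qed.

Lemma alt_span_word r :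
  alt_span (\prod_(b <- r) (unitz_in (iota b) * unitz_in (X + Y)))
           (word_op Psi (X + Y) r).
Proof.
elim: r => [|b r IH].
  apply: (@AltSpan true [::] 1) => //; first by rewrite big_nil lprod_nil uemb1 mulr1.
  move=> h _; apply/funext => r; apply/funext => a.
  by rewrite /rmul /= uemb1 mulr1.
have hX : letter true (unitz_in (iota b) * unitz_in X)
    (rmul (unitz_in (iota b)) \o mark Psi X).
  by have := MarkedX b (Marked1 Psi X); rewrite mul1r.
have hY : letter false (unitz_in (iota b) * unitz_in Y)
    (rmul (unitz_in (iota b) * unitz_in Y)).
  split=> //; apply: in_ugenM; last exact: in_ugen_var.
  by rewrite -uemb_in; exact: in_ugen_emb.
apply: (AltSpanD (alt_spanM hX IH) (alt_spanM hY IH)).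
  by rewrite big_cons linearD mulrDr mulrDl.
move=> h hh; have [g1 _] := multiadditive_word_op (X + Y) r hh.
apply/funext => k; apply/funext => a.
rewrite /= /rmul /mark linearD mulrDr -[a * _ * unitz_in Y]mulrA addrAC.
have gD u v : word_op Psi (X + Y) r h k (u + v) =
    word_op Psi (X + Y) r h k u + word_op Psi (X + Y) r h k v.
  by apply/eqP; rewrite -subr_eq -g1 addrK.
by rewrite gD.
Qed.

Section Read.
Hypothesis free : c_free Phi Psi X Y.
Variable w : mul_series B.
Hypothesis hw : cR_recurrence (moment_series Phi X) (moment_series Psi X) w.

(** After a polynomial v in X and the centered letters l0, no mark survives in
    an alternating product l of centered letters that continues l0.  If l starts
    with a letter in X, then l0 is not empty and ends with a letter in Y, so the
    current product is of the form treated by [Psi_split2]. *)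
Lemma alternating_read l k v (l0 : seq (unitization A)) h :
  in_ugen iota X v -> centered Psi X Y false l0 ->
  alternating (odd (size l0)) l -> multiadditive h ->
  lop l h k (v * \prod_(x <- l0) x) = h k (v * \prod_(x <- l0) x * lprod l).
Proof.
move=> hv + + hh; elim: l l0 => [|[q Q] l IH] l0 hl0 /=.
  by rewrite lprod_nil mulr1.
move=> [hq q0 hl]; have qX := letter_in hq.
have hr : centered Psi X Y false (rcons l0 q) by exact: centered_rcons.
have := IH _ hr; rewrite size_rcons big_rcons /= => /(_ hl).
rewrite lprod_cons !mulrA => <-.
move: hq hl0 hl hr {IH qX}; case e: (odd (size l0)) => /= hq hl0 hl hr; last first.
  by case: hq => _ ->.
apply: (marked_poly_unmarked _ hq) => [|u hu].
  exact: multiadditive_lop hl hh.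
apply: (@Psi_split2 _ _ _ _ _ _ _ _ free true) => //; last by rewrite e.
by case: (l0) e.
Qed.

(** For an alternating product of centered letters, only the marks in a leading
    polynomial in X survive, and the rest factors out of Phi. *)
Lemma alt_span_read t T : alt_span t T ->
  T (read Phi w 1) [::] 1 = uexp Phi (unitz_in X * t).
Proof.
elim=> {t T} [s l c t T hl -> hT|t T t1 T1 t2 T2 _ h1 _ h2 -> hT]; last first.
  by rewrite hT ?h1 ?h2 ?mulrDr ?uexpD//; exact: multiadditive_read.
rewrite hT ?read_rmul ?mulr1; last exact: multiadditive_read.
have base l' k v d : alternating false l' -> in_ugen iota X v ->
    lop l' (read Phi w d) k v = read Phi w (uexp Phi (lprod l') * d) k v.
  move=> hl' hv; have := @alternating_read l' k v [::] (read Phi w d) hv I hl'.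
  rewrite big_nil mulr1 => -> //; last exact: multiadditive_read.
  rewrite /read /lprod (@Phi_split _ _ _ _ _ _ _ _ free true)//.
    by rewrite !mulrA.
  exact: alternating_centered.
have split l' v : alternating false l' -> in_ugen iota X v ->
    uexp Phi (v * (lprod l' * uemb c)) = uexp Phi v * (uexp Phi (lprod l') * c).
  move=> hl' hv; rewrite mulrA uexp_embr /lprod mulrA.
  by rewrite (@Phi_split _ _ _ _ _ _ _ _ free true)//; exact: alternating_centered.
case: s hl => hl; last first.
  rewrite base//; last exact: in_ugen1.
  rewrite split//; last exact: in_ugen_var.
  have /= -> := marked_poly_read hw (uexp Phi (lprod l) * c) (Marked1 Psi X).
  by rewrite mulr1.
case: l hl {hT} => [_|[q Q] l /= [hq _ hl]].
  have /= -> := marked_poly_read hw c (Marked1 Psi X).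
  by rewrite lprod_nil mul1r mulr1 uexp_embr.
have -> : Q (lop l (read Phi w c)) [::] 1 =
    Q (read Phi w (uexp Phi (lprod l) * c)) [::] 1.
  apply: (marked_poly_ext hq); last exact: in_ugen1.
  by move=> k v; exact: base.
rewrite (marked_poly_read hw _ hq) lprod_cons -[q * _ * _]mulrA.
rewrite (mulrA (unitz_in X)) split//.
by apply: in_ugenM; [exact: in_ugen_var|exact: marked_poly_in hq].
Qed.

(** The moments of words in X + Y that start with X are obtained by putting marks
    on X + Y while using the R-transform of X.  The operator of X + Y acts as that
    of X, with its marks, plus that of Y, without marks. *)
Lemma word_op_cfree r : word_op Psi (X + Y) r (read Phi w 1) [::] 1 =
  uexp Phi (unitz_in X * \prod_(b <- r) (unitz_in (iota b) * unitz_in (X + Y))).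
Proof. exact/alt_span_read/alt_span_word. Qed.

End Read.

End AlternatingSpan.

Section Additivity.
Context (C : numClosedFieldType) (B A : starAlgType C).
Context (iota : star_embedding B A) (Phi Psi : cond_exp iota).

Lemma c_free_sym X Y : c_free Phi Psi X Y -> c_free Phi Psi Y X.
Proof.
move=> free m eps a ha heps a0.
apply: (free m (fun k => ~~ eps k) a) => // k km.
  by have := ha k km; case: (eps k).
by move=> /negb_inj; exact: heps.
Qed.

Lemma word_op_read_add Z (v w : mul_series B) r k a :
  word_op Psi Z r (read Phi (mul_series_add v w) 1) k a =
  word_op Psi Z r (read Phi v 1) k a + word_op Psi Z r (read Phi w 1) k a.
Proof.
elim: r k a => [|b r IH] k a /=; first by rewrite /read !mulr1 coefs_add mulrDl.
by rewrite /rmul /mark !IH addrACA.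
Qed.

Lemma cR_of_add X Y : c_free Phi Psi X Y ->
  cR_of Phi Psi (X + Y) = mul_series_add (cR_of Phi Psi X) (cR_of Phi Psi Y).
Proof.
move=> free; apply: cR_recurrence_uniq (cRP _ _) _ => n b.
rewrite sum_cR_term word_op_read_add word_op_cfree//; last exact: cRP.
rewrite [X + Y]addrC word_op_cfree; [|exact: c_free_sym|exact: cRP].
by rewrite -uexpD -mulrDl addrC -linearD coef_moment codom_args big_map.
Qed.

End Additivity.

Theorem theorem3p6 (R : realType) (B : cstarAlgType R) (A : starAlgType R[i])
    (iota : star_embedding B A) (Phi Psi : cond_exp iota) (X Y : A) :
  c_free Phi Psi X Y ->
  cR_of Phi Psi (X + Y) = mul_series_add (cR_of Phi Psi X) (cR_of Phi Psi Y).
Proof. exact: cR_of_add. Qed.
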